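(* Let $\theta,\kappa>0$ and $\varepsilon_0\in(0,\tfrac12]$. There exists a positive constant $K=K(\varepsilon_0,\kappa,\theta)$ such that $$H_{\nu^n_{u(\cdot)}}(f)\le\frac{n^2}{K}\,\mathcal D(\sqrt f)$$ for every $n\in\{2,3,\dots\}$, every $u\in\mathcal U^n_{\kappa,\varepsilon_0}$ and every density $f$ with respect to $\nu^n_{u(\cdot)}$.
   Context: For $n\in\{2,3,\dots\}$ let $\Lambda_n:=\{1,\dots,n-1\}$ and $\Omega_n:=\{0,1\}^{\Lambda_n}$. For $\eta\in\Omega_n$, $\eta^{x,y}$ denotes the configuration obtained from $\eta$ by exchanging the values $\eta(x)$ and $\eta(y)$, and $\eta^x$ the configuration obtained by replacing $\eta(x)$ by $1-\eta(x)$. For $f:\Omega_n\to\mathbb R$ put $\nabla_{x,y}f(\eta)=f(\eta^{x,y})-f(\eta)$ and $\nabla_xf(\eta)=f(\eta^x)-f(\eta)$. $\mathcal U^n_{\kappa,\varepsilon_0}$ is the class of functions $u:\Lambda_n\to[0,1]$ such that $\varepsilon_0\le u(x)\le1-\varepsilon_0$ for every $x\in\Lambda_n$ and $n|u(x+1)-u(x)|\le\kappa$ for every $x\in\{1,\dots,n-2\}$. For such $u$, $\nu^n_{u(\cdot)}(\eta):=\prod_{x\in\Lambda_n}\{\eta(x)u(x)+(1-\eta(x))(1-u(x))\}$ is the Bernoulli product measure on $\Omega_n$ with density $u$. For $f:\Omega_n\to\mathbb R$ define $$\mathcal D_x(f):=\int(\nabla_xf)^2\,d\nu^n_{u(\cdot)}\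 (x\in\Lambda_n),\qquad \mathcal D_{x,x+1}(f):=\int(\nabla_{x,x+1}f)^2\,d\nu^n_{u(\cdot)}\ (1\le x\le n-2),$$ $$\mathcal D(f):=\frac\theta n\,\mathcal D_1(f)+\sum_{x=1}^{n-2}\mathcal D_{x,x+1}(f).$$ A density with respect to a probability measure $\nu$ on $\Omega_n$ is a function $f:\Omega_n\to[0,\infty)$ with $\int f\,d\nu=1$; its relative entropy is $H_\nu(f):=\int f\log f\,d\nu$ (with $0\log0=0$). *)

(* Defs.v *)
From HB Require Import structures.
From mathcomp Require Import all_boot all_order all_fingroup all_algebra.
From mathcomp Require Import reals exp.

Set Implicit Arguments.
Unset Strict Implicit.
Unset Printing Implicit Defensive.

Import Order.TTheory GRing.Theory Num.Theory.
Local Open Scope ring_scope.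

(* For n >= 2 this has exactly n - 1 elements; the ordinal i stands for the
   site i + 1 of {1, ..., n - 1}. Writing n.-2.+1 instead of n.-1 makes the
   leftmost site available as ord0; the values n = 0, 1 are junk. *)
Definition Lambda (n : nat) : finType := 'I_n.-2.+1.

Definition first_site (n : nat) : Lambda n := ord0.

(* y is the right neighbour x + 1 of x. *)
Definition right_nbr (n : nat) (x y : Lambda n) : bool :=
  nat_of_ord y == (nat_of_ord x).+1.

Definition Omega (n : nat) : finType := {ffun Lambda n -> bool}.

Definition exchange (n : nat) (x y : Lambda n) (eta : Omega n) : Omega n :=
  [ffun z => eta (tperm x y z)].

Definition flip (n : nat) (x : Lambda n) (eta : Omega n) : Omega n :=
  [ffun z => if z == x then ~~ eta z else eta z].

Definition grad_exch (R : realType) (n : nat) (x y : Lambda n)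
    (f : Omega n -> R) : Omega n -> R :=
  fun eta => f (exchange x y eta) - f eta.

Definition grad_flip (R : realType) (n : nat) (x : Lambda n)
    (f : Omega n -> R) : Omega n -> R :=
  fun eta => f (flip x eta) - f eta.

Definition profile_class (R : realType) (n : nat) (kappa eps0 : R)
    (u : Lambda n -> R) : Prop :=
  [/\ forall x, 0 <= u x <= 1,
      forall x, eps0 <= u x <= 1 - eps0
    & forall x y, right_nbr x y -> n%:R * `|u y - u x| <= kappa].

Definition bernoulli_prod (R : realType) (n : nat) (u : Lambda n -> R) :
    Omega n -> R :=
  fun eta => \prod_(x : Lambda n)
    ((eta x)%:R * u x + (1 - (eta x)%:R) * (1 - u x)).

(* A measure on the finite set Omega n is given by its point masses, so that
   integration is a finite sum. *)
Definition integral (R : realType) (n : nat) (nu f : Omega n -> R) : R :=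
  \sum_(eta : Omega n) f eta * nu eta.

Definition dirichlet_flip (R : realType) (n : nat) (u : Lambda n -> R)
    (x : Lambda n) (f : Omega n -> R) : R :=
  integral (bernoulli_prod u) (fun eta => grad_flip x f eta ^+ 2).

Definition dirichlet_exch (R : realType) (n : nat) (u : Lambda n -> R)
    (x y : Lambda n) (f : Omega n -> R) : R :=
  integral (bernoulli_prod u) (fun eta => grad_exch x y f eta ^+ 2).

Definition dirichlet (R : realType) (n : nat) (theta : R) (u : Lambda n -> R)
    (f : Omega n -> R) : R :=
  theta / n%:R * dirichlet_flip u (first_site n) f
  + \sum_(x : Lambda n) \sum_(y : Lambda n | right_nbr x y)
      dirichlet_exch u x y f.

Definition density (R : realType) (n : nat) (nu f : Omega n -> R) : Prop :=
  (forall eta, 0 <= f eta) /\ integral nu f = 1.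

(* The convention 0 log 0 = 0 is automatic, being a product with 0. *)
Definition entropy (R : realType) (n : nat) (nu f : Omega n -> R) : R :=
  integral nu (fun eta => f eta * ln (f eta)).

(* Main.v *)
Require Import Defs.
From HB Require Import structures.
From mathcomp Require Import all_boot all_order all_fingroup all_algebra.
From mathcomp Require Import reals exp.
From mathcomp Require Import sequences.
From mathcomp Require Import ring lra.

Set Implicit Arguments.
Unset Strict Implicit.
Unset Printing Implicit Defensive.

Import Order.TTheory GRing.Theory Num.Theory.
Local Open Scope ring_scope.

(** Averaging out the sites one at a time telescopes the entropy into two-point
    entropies. On two points the entropy is controlled by the squared jump of
    sqrt f, and by joint convexity of (a, c) |-> (sqrt a - sqrt c)^2 averaging
    over other sites does not increase these jumps; hence the entropy is at
    most a constant times the sum over x of D_x(sqrt f).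
    To flip the spin at x + 1, exchange it with x, flip at x, and exchange
    back. As u varies by at most kappa / n per bond, an exchange distorts the
    measure by a factor 1 + O(1/n), and the weighted Young inequality gives
    D_{x+1} <= (1 + c/n) D_x + C n D_{x,x+1}. Iterating at most n times yields
    D_x <= C' (D_1 + n sum_y D_{y,y+1}), and summing over the at most n sites x
    produces n^2 (D_1 / n + sum_y D_{y,y+1}) up to a constant. *)

(** * Scalar inequalities for square roots and logarithms *)

(** After expanding, the square terms agree on both sides; what remains is Cauchy-Schwarz for the
    cross terms, proved as [cs]. *)
Lemma sqrt_mean_dist_le (R : realType) (p q a b c d : R) :
  0 <= p -> 0 <= q -> 0 <= a -> 0 <= b -> 0 <= c -> 0 <= d ->
  (Num.sqrt (p * a + q * b) - Num.sqrt (p * c + q * d)) ^+ 2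
    <= p * (Num.sqrt a - Num.sqrt c) ^+ 2
       + q * (Num.sqrt b - Num.sqrt d) ^+ 2.
Proof.
move=> p0 q0 a0 b0 c0 d0.
have Ea := sqr_sqrtr a0; have Eb := sqr_sqrtr b0.
have Ec := sqr_sqrtr c0; have Ed := sqr_sqrtr d0.
have := sqrtr_ge0 a; have := sqrtr_ge0 b.
have := sqrtr_ge0 c; have := sqrtr_ge0 d.
move: (Num.sqrt a) (Num.sqrt b) (Num.sqrt c) (Num.sqrt d) Ea Eb Ec Ed.
move=> A B C D <- <- <- <- D0 C0 B0 A0.
have X0 : 0 <= p * A ^+ 2 + q * B ^+ 2 by rewrite addr_ge0 ?mulr_ge0 ?sqr_ge0.
have Y0 : 0 <= p * C ^+ 2 + q * D ^+ 2 by rewrite addr_ge0 ?mulr_ge0 ?sqr_ge0.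
have cs : p * (A * C) + q * (B * D) <=
    Num.sqrt (p * A ^+ 2 + q * B ^+ 2) * Num.sqrt (p * C ^+ 2 + q * D ^+ 2).
  rewrite -sqrtrM //.
  have Z0 : 0 <= p * (A * C) + q * (B * D) by rewrite addr_ge0 ?mulr_ge0.
  rewrite -[leLHS](ger0_norm Z0) -sqrtr_sqr ler_sqrt ?mulr_ge0 //.
  rewrite -subr_ge0.
  have -> : (p * A ^+ 2 + q * B ^+ 2) * (p * C ^+ 2 + q * D ^+ 2)
      - (p * (A * C) + q * (B * D)) ^+ 2 = p * q * (A * D - B * C) ^+ 2 by ring.
  by rewrite mulr_ge0 ?sqr_ge0 ?mulr_ge0.
rewrite (sqrrB (Num.sqrt _)) !sqr_sqrtr //; nra.
Qed.

Lemma xlnx_sub_le (R : realType) (a m : R) :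
  0 <= a -> 0 < m -> a * ln a - a * ln m <= a ^+ 2 / m - a.
Proof.
move=> a0 m0; case: (eqVneq a 0) => [->|an0]; first by rewrite !mul0r expr0n /=; lra.
have ap : 0 < a by rewrite lt_neqAle eq_sym an0.
rewrite -mulrBr -ln_div ?posrE //.
have -> : a ^+ 2 / m - a = a * (a / m - 1) by ring.
rewrite ler_pM2l //.
have := @le_ln1Dx R (a / m - 1).
have -> : 1 + (a / m - 1) = a / m by ring.
by apply; have := divr_gt0 ap m0; lra.
Qed.

(* Since ln x <= x - 1, the entropy is at most variance / mean, and the mean
   dominates e (sqrt a + sqrt b)^2 / 2. *)
Lemma two_point_logsob (R : realType) (e p q a b : R) :
  0 < e -> e <= p -> e <= q -> p + q = 1 -> 0 <= a -> 0 <= b ->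
  p * (a * ln a) + q * (b * ln b) - (p * a + q * b) * ln (p * a + q * b)
    <= 2 / e * (Num.sqrt a - Num.sqrt b) ^+ 2.
Proof.
move=> e0 ep eq pq a0 b0.
have p0 : 0 < p := lt_le_trans e0 ep.
have q0 : 0 < q := lt_le_trans e0 eq.
set m := p * a + q * b.
have m_ge0 : 0 <= m by rewrite addr_ge0 // mulr_ge0 // ltW.
have rhs0 : 0 <= 2 / e * (Num.sqrt a - Num.sqrt b) ^+ 2.
  by rewrite mulr_ge0 ?sqr_ge0 // divr_ge0 // ltW.
case: (eqVneq m 0) => [m0|mn0].
  have a_eq0 : a = 0 by rewrite /m in m0; nra.
  have b_eq0 : b = 0 by rewrite /m in m0; nra.
  by rewrite m0 a_eq0 b_eq0 subrr expr0n /= !(mul0r, mulr0) addr0 subrr.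
have mp : 0 < m by rewrite lt_neqAle eq_sym mn0.
have ha := xlnx_sub_le a0 mp; have hb := xlnx_sub_le b0 mp.
apply: (@le_trans _ _ ((p * a ^+ 2 + q * b ^+ 2) / m - m)).
  have -> : (p * a ^+ 2 + q * b ^+ 2) / m - m
      = p * (a ^+ 2 / m - a) + q * (b ^+ 2 / m - b) by rewrite /m; ring.
  have -> : p * (a * ln a) + q * (b * ln b) - m * ln m
      = p * (a * ln a - a * ln m) + q * (b * ln b - b * ln m) by rewrite {1}/m; ring.
  by rewrite lerD // ler_pM2l.
have -> : (p * a ^+ 2 + q * b ^+ 2) / m - m
    = p * q * (a - b) ^+ 2 / m.
  have qE : q = 1 - p by rewrite -pq; ring.
  have mE : m * m / m = m by rewrite mulfK.
  by rewrite -[X in _ - X]mE -mulrBl; congr (_ / _); rewrite /m qE; ring.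
rewrite ler_pdivrMr //.
have -> : 2 / e * (Num.sqrt a - Num.sqrt b) ^+ 2 * m
    = 2 * (Num.sqrt a - Num.sqrt b) ^+ 2 * m / e by ring.
rewrite ler_pdivlMr //.
rewrite /m; have Ea := sqr_sqrtr a0; have Eb := sqr_sqrtr b0.
have := sqrtr_ge0 a; have := sqrtr_ge0 b.
move: (Num.sqrt a) (Num.sqrt b) Ea Eb => A B <- <- B0 A0.
have -> : A ^+ 2 - B ^+ 2 = (A - B) * (A + B) by ring.
rewrite exprMn.
have pq1 : p * q <= 1 by nra.
have s : e * (A + B) ^+ 2 <= 2 * (p * A ^+ 2 + q * B ^+ 2).
  have : e * (A + B) ^+ 2 <= e * (2 * (A ^+ 2 + B ^+ 2)).
    by rewrite ler_pM2l //; have := sqr_ge0 (A - B); nra.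
  have : e * A ^+ 2 <= p * A ^+ 2 by rewrite ler_wpM2r ?sqr_ge0.
  have : e * B ^+ 2 <= q * B ^+ 2 by rewrite ler_wpM2r ?sqr_ge0.
  by lra.
have D0 := sqr_ge0 (A - B); have S0 := sqr_ge0 (A + B).
have -> : p * q * ((A - B) ^+ 2 * (A + B) ^+ 2) * e
    = p * q * ((A - B) ^+ 2 * (e * (A + B) ^+ 2)) by ring.
apply: (@le_trans _ _ ((A - B) ^+ 2 * (e * (A + B) ^+ 2))).
  by rewrite ler_piMl // mulr_ge0 // mulr_ge0 // ltW.
by rewrite -mulrA [leRHS]mulrCA ler_wpM2l.
Qed.

(** * One-site laws, flips and exchanges *)

Definition site_prob (R : realType) (n : nat) (u : Lambda n -> R)
    (x : Lambda n) (b : bool) : R :=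
  b%:R * u x + (1 - b%:R) * (1 - u x).

(* Conditional expectation given all the spins but the one at x. *)
Definition site_avg (R : realType) (n : nat) (u : Lambda n -> R)
    (x : Lambda n) (f : Omega n -> R) : Omega n -> R :=
  fun eta => site_prob u x (eta x) * f eta
             + site_prob u x (~~ eta x) * f (flip x eta).

Section Flip.
Variable n : nat.
Implicit Types (x y : Lambda n) (eta zeta : Omega n).

Lemma flipK x : involutive (@flip n x).
Proof. by move=> eta; apply/ffunP=> z; rewrite !ffunE; case: eqP => // _; rewrite negbK. Qed.

Lemma flip_comm x y eta : flip x (flip y eta) = flip y (flip x eta).
Proof. by apply/ffunP=> z; rewrite !ffunE; case: ifP; case: ifP. Qed.

Lemma flip_same x eta : flip x eta x = ~~ eta x.
Proof. by rewrite ffunE eqxx. Qed.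

Lemma flip_other x y eta : y != x -> flip x eta y = eta y.
Proof. by rewrite ffunE => /negbTE ->. Qed.

Lemma exchangeK x y : involutive (@exchange n x y).
Proof. by move=> eta; apply/ffunP=> z; rewrite !ffunE tpermK. Qed.

(** Conjugating by a transposition relabels the flipped site, so a flip at one site can be carried
    to another. *)
Lemma flip_exchange x y eta :
  flip y eta = exchange x y (flip x (exchange x y eta)).
Proof.
apply/ffunP=> z; rewrite !ffunE tpermK.
have -> : (tperm x y z == x) = (z == y); last by [].
by rewrite -[X in _ == X](tpermR x y) (inj_eq perm_inj).
Qed.

(** Induction on the number of sites where the configurations differ: flipping one such site lowers
    it. *)
Lemma flip_invariant_const (T : Type) (g : Omega n -> T) :
  (forall x eta, g (flip x eta) = g eta) -> forall eta zeta, g eta = g zeta.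
Proof.
move=> gflip eta zeta.
have [k] := ubnP #|[set x | eta x != zeta x]|.
elim: k eta => // k IHk eta; rewrite ltnS => cardk.
case: (pickP (fun x => eta x != zeta x)) => [x neq|eq]; last first.
  by congr g; apply/ffunP=> x; apply/eqP; move: (eq x) => /negbFE.
rewrite -(gflip x eta); apply: IHk; apply: leq_trans cardk.
apply: proper_card; apply/properP; split.
  by apply/subsetP=> z; rewrite !inE ffunE; case: (eqVneq z x) => [->|].
by exists x; rewrite !inE // flip_same; case: (eta x) neq; case: (zeta x).
Qed.

End Flip.

(** * Distortion of the product measure under flips and exchanges *)

Section Bernoulli.
Variables (R : realType) (n : nat) (u : Lambda n -> R) (eps0 : R).
Hypotheses (eps0_gt0 : 0 < eps0) (u_bd : forall x, eps0 <= u x <= 1 - eps0).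
Implicit Types (x y : Lambda n) (eta : Omega n) (f g : Omega n -> R).

Local Notation nu := (bernoulli_prod u).

Lemma site_prob_ge x b : eps0 <= site_prob u x b.
Proof. by have /andP[? ?] := u_bd x; case: b; rewrite /site_prob /=; lra. Qed.

Lemma site_prob_gt0 x b : 0 < site_prob u x b.
Proof. exact: lt_le_trans (site_prob_ge x b). Qed.

Lemma site_prob_compl x b : site_prob u x b + site_prob u x (~~ b) = 1.
Proof. by case: b; rewrite /site_prob /=; ring. Qed.

Lemma bernoulli_gt0 eta : 0 < nu eta.
Proof. by apply: prodr_gt0 => x _; apply: site_prob_gt0. Qed.

(** Detailed balance, cross-multiplied to avoid division: only the factor at [x] changes. *)
Lemma bernoulli_flip x eta :
  nu (flip x eta) * site_prob u x (eta x) = nu eta * site_prob u x (~~ eta x).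
Proof.
rewrite /bernoulli_prod (bigD1 x) //= [in RHS](bigD1 x) //=.
rewrite flip_same -!/(site_prob u x _).
rewrite (eq_bigr (fun i => site_prob u i (eta i))); last first.
  by move=> y yx; rewrite flip_other.
by rewrite /site_prob; ring.
Qed.

Lemma bernoulli_flip_le x eta : nu (flip x eta) <= eps0^-1 * nu eta.
Proof.
rewrite mulrC ler_pdivlMr //.
have h := bernoulli_flip x eta.
have c := site_prob_compl x (eta x).
have p0 := site_prob_ge x (eta x); have q0 := site_prob_gt0 x (~~ eta x).
have v0 := bernoulli_gt0 eta; have w0 := bernoulli_gt0 (flip x eta).
nra.
Qed.

(** Only two factors change. Their product moves by at most [d] and was at least [eps0 ^+ 2], which
    gives the relative error. *)
Lemma bernoulli_exchange_le (d : R) x y eta :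
  x != y -> `|u y - u x| <= d ->
  nu (exchange x y eta) <= (1 + d / eps0 ^+ 2) * nu eta.
Proof.
move=> xy ud; have yx : y != x by rewrite eq_sym.
rewrite /bernoulli_prod (bigD1 x) //= (bigD1 y) ?yx //=.
rewrite [in leRHS](bigD1 x) //= [in leRHS](bigD1 y) ?yx //=.
rewrite -!/(site_prob u _ _) !ffunE tpermL tpermR.
under eq_bigr => z /andP[zx zy] do rewrite -/(site_prob u z _) ffunE tpermD 1?eq_sym //.
under [in leRHS]eq_bigr => z /andP[zx zy] do rewrite -/(site_prob u z _).
set P := \prod_(z | _) _.
have P0 : 0 < P by apply: prodr_gt0 => z _; apply: site_prob_gt0.
rewrite !mulrA ler_pM2r //.
have px := site_prob_ge x (eta x); have py := site_prob_ge y (eta y).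
have d0 : 0 <= d := le_trans (normr_ge0 _) ud.
have key : site_prob u x (eta y) * site_prob u y (eta x)
    <= site_prob u x (eta x) * site_prob u y (eta y) + d.
  move: ud; rewrite ler_norml => /andP[ud1 ud2].
  by case: (eta x); case: (eta y); rewrite /site_prob /=; lra.
apply: (le_trans key); rewrite -[leRHS]mulrA [leRHS]mulrDl mul1r lerD2l.
rewrite -mulrA ler_peMr // mulrC ler_pdivlMr ?exprn_gt0 // mul1r expr2.
by apply: ler_pM => //; apply: ltW.
Qed.

(** * Integrals and site averages *)

Lemma integral_le f g :
  (forall eta, f eta <= g eta) -> integral nu f <= integral nu g.
Proof. by move=> fg; apply: ler_sum => eta _; rewrite ler_pM2r ?bernoulli_gt0. Qed.

Lemma integral_ge0 f : (forall eta, 0 <= f eta) -> 0 <= integral nu f.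
Proof. by move=> f0; apply: sumr_ge0 => eta _; rewrite mulr_ge0 // ltW ?bernoulli_gt0. Qed.

Lemma integralD f g :
  integral nu (fun eta => f eta + g eta) = integral nu f + integral nu g.
Proof. by rewrite /integral -big_split; apply: eq_bigr => eta _; rewrite mulrDl. Qed.

Lemma integralZ (c : R) f :
  integral nu (fun eta => c * f eta) = c * integral nu f.
Proof. by rewrite /integral mulr_sumr; apply: eq_bigr => eta _; rewrite mulrA. Qed.

Lemma integral_invol_le (s : Omega n -> Omega n) (c : R) f :
  involutive s -> (forall eta, nu (s eta) <= c * nu eta) ->
  (forall eta, 0 <= f eta) ->
  integral nu (fun eta => f (s eta)) <= c * integral nu f.
Proof.
move=> sK sc f0; rewrite /integral (reindex_inj (inv_inj sK)) mulr_sumr.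
by apply: ler_sum => eta _; rewrite sK mulrCA ler_wpM2l.
Qed.

(** Reindexing the flipped term by the flip and applying detailed balance leaves [f] weighted by two
    probabilities that add up to 1. *)
Lemma integral_site_avg x f : integral nu (site_avg u x f) = integral nu f.
Proof.
rewrite /site_avg integralD.
have -> : integral nu (fun eta => site_prob u x (~~ eta x) * f (flip x eta))
    = integral nu (fun eta => site_prob u x (~~ eta x) * f eta).
  rewrite /integral (reindex_inj (inv_inj (@flipK n x))).
  apply: eq_bigr => eta _; rewrite flipK flip_same negbK.
  by rewrite [LHS]mulrC [LHS]mulrA bernoulli_flip; ring.
rewrite -integralD; apply: eq_bigr => eta _.
by rewrite -mulrDl site_prob_compl mul1r.
Qed.

Lemma site_avg_ge0 x f :
  (forall eta, 0 <= f eta) -> forall eta, 0 <= site_avg u x f eta.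
Proof. by move=> f0 eta; rewrite addr_ge0 // mulr_ge0 // ltW ?site_prob_gt0. Qed.

Lemma site_avg_flip x f eta : site_avg u x f (flip x eta) = site_avg u x f eta.
Proof. by rewrite /site_avg flip_same flipK negbK addrC. Qed.

Lemma site_avg_flip_other x y f :
  (forall eta, f (flip x eta) = f eta) ->
  forall eta, site_avg u y f (flip x eta) = site_avg u y f eta.
Proof.
move=> fx eta; case: (eqVneq y x) => [->|yx]; first exact: site_avg_flip.
by rewrite /site_avg flip_other // flip_comm !fx.
Qed.

(** * Entropy bounded by single-site jumps *)

(** Flips commute, so [sqrt_mean_dist_le] applies pointwise once the right-hand integrand is itself
    averaged at [y]. *)
Lemma dirichlet_flip_site_avg x y f :
  y != x -> (forall eta, 0 <= f eta) ->
  dirichlet_flip u x (fun eta => Num.sqrt (site_avg u y f eta))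
    <= dirichlet_flip u x (fun eta => Num.sqrt (f eta)).
Proof.
move=> yx f0; rewrite /dirichlet_flip.
rewrite -[leRHS](integral_site_avg y).
apply: integral_le => eta; rewrite /grad_flip /site_avg.
rewrite flip_other // (flip_comm y x).
by apply: sqrt_mean_dist_le => //; apply/ltW/site_prob_gt0.
Qed.

(** Given the other spins, site [x] is a two-point space with mean [site_avg u x f]; the two-point
    bound is integrated. *)
Lemma entropy_site_avg x f : (forall eta, 0 <= f eta) ->
  entropy nu f <= entropy nu (site_avg u x f)
    + 2 / eps0 * dirichlet_flip u x (fun eta => Num.sqrt (f eta)).
Proof.
move=> f0; rewrite /entropy -[leLHS](integral_site_avg x).
rewrite -integralZ -integralD; apply: integral_le => eta.
rewrite addrC -lerBlDr /grad_flip -sqrrN opprB.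
apply: two_point_logsob => //; last exact: site_prob_compl.
- exact: site_prob_ge.
- exact: site_prob_ge.
Qed.

(* Averaging out the sites of s one after the other telescopes the entropy. *)
Lemma entropy_telescope (s : seq (Lambda n)) f :
  uniq s -> (forall eta, 0 <= f eta) ->
  entropy nu f <= entropy nu (foldl (fun g x => site_avg u x g) f s)
    + 2 / eps0 * \sum_(x <- s) dirichlet_flip u x (fun eta => Num.sqrt (f eta)).
Proof.
elim: s f => [|x s IHs] f /=; first by rewrite big_nil mulr0 addr0.
move=> /andP[xs us] f0; rewrite big_cons mulrDr.
apply: (le_trans (entropy_site_avg x f0)).
rewrite [X in _ <= _ + X]addrC addrA lerD2r.
apply: (le_trans (IHs _ us (site_avg_ge0 x f0))); rewrite lerD2l.
apply: ler_wpM2l; first by rewrite divr_ge0 // ltW.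
rewrite big_seq [leRHS]big_seq; apply: ler_sum => y ys.
apply: dirichlet_flip_site_avg => //.
by apply: contraNneq xs => ->.
Qed.

(** The disjunction is the induction invariant: [x] is still to be averaged, or invariance at [x] is
    already gained and later averages keep it. *)
Lemma foldl_site_avg_flip (s : seq (Lambda n)) f x :
  x \in s \/ (forall eta, f (flip x eta) = f eta) ->
  forall eta, foldl (fun g x => site_avg u x g) f s (flip x eta)
              = foldl (fun g x => site_avg u x g) f s eta.
Proof.
elim: s f => [|y s IHs] f /= h eta; first by case: h.
apply: IHs; case: h => [|fx]; last by right; apply: site_avg_flip_other.
rewrite inE => /predU1P[->|xs]; last by left.
by right; apply: site_avg_flip.
Qed.

Lemma integral_foldl_site_avg (s : seq (Lambda n)) f :
  integral nu (foldl (fun g x => site_avg u x g) f s) = integral nu f.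
Proof. by elim: s f => //= x s IHs f; rewrite IHs integral_site_avg. Qed.

Lemma bernoulli_total : \sum_eta nu eta = 1.
Proof.
rewrite /bernoulli_prod -(bigA_distr_bigA (fun x b => site_prob u x b)).
by apply: big1 => x _; rewrite big_bool -(site_prob_compl x true).
Qed.

(** Once every site is averaged, the function is flip-invariant, hence constant, hence 1, and has no
    entropy left. *)
Lemma product_logsob f : density nu f ->
  entropy nu f
    <= 2 / eps0 * \sum_x dirichlet_flip u x (fun eta => Num.sqrt (f eta)).
Proof.
case=> f0 f1; apply: (le_trans (entropy_telescope (index_enum_uniq _) f0)).
rewrite gerDr; set g := foldl _ _ _.
have gc : forall eta zeta, g eta = g zeta.
  apply: flip_invariant_const => x eta; apply: foldl_site_avg_flip.
  by left; apply: mem_index_enum.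
have g1 eta : g eta = 1.
  rewrite -f1 -(integral_foldl_site_avg (index_enum (Lambda n))) -/g.
  rewrite /integral; under eq_bigr => zeta _ do rewrite (gc zeta eta).
  by rewrite -mulr_sumr bernoulli_total mulr1.
by rewrite /entropy /integral big1 // => eta _; rewrite g1 ln1 mulr0 mul0r.
Qed.

(** * Transport of the flip from the first site *)

(* Split flip y = exchange . flip x . exchange and apply the weighted Young
   inequality (a + b + c)^2 <= (1 + t) b^2 + 2 (1 + 1/t) (a^2 + c^2). *)
Lemma dirichlet_flip_step (t d : R) x y g :
  0 < t -> x != y -> `|u y - u x| <= d ->
  dirichlet_flip u y g
    <= (1 + t) * (1 + d / eps0 ^+ 2) * dirichlet_flip u x g
       + 2 * (1 + t^-1) * ((1 + d / eps0 ^+ 2) / eps0 + 1)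
         * dirichlet_exch u x y g.
Proof.
move=> t0 xy ud; set r := 1 + d / eps0 ^+ 2.
have d0 : 0 <= d := le_trans (normr_ge0 _) ud.
have r0 : 0 <= r by rewrite addr_ge0 // divr_ge0 // sqr_ge0.
pose s := @exchange n x y; pose p := @flip n x.
have sle (f : Omega n -> R) : (forall eta, 0 <= f eta) ->
    integral nu (fun eta => f (s eta)) <= r * integral nu f.
  apply: integral_invol_le; first exact: exchangeK.
  by move=> eta; apply: bernoulli_exchange_le.
have ple (f : Omega n -> R) : (forall eta, 0 <= f eta) ->
    integral nu (fun eta => f (p eta)) <= eps0^-1 * integral nu f.
  apply: integral_invol_le; first exact: flipK.
  by move=> eta; apply: bernoulli_flip_le.
pose F eta := grad_flip x g eta ^+ 2.
pose E eta := grad_exch x y g eta ^+ 2.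
have F0 eta : 0 <= F eta by apply: sqr_ge0.
have E0 eta : 0 <= E eta by apply: sqr_ge0.
(* Along the path [eta], [s eta], [p (s eta)], [s (p (s eta))] the squared increments of [g] are
   [E eta], [F (s eta)] and [E (p (s eta))]. *)
apply: (@le_trans _ _ (integral nu (fun eta => (1 + t) * F (s eta)
    + 2 * (1 + t^-1) * (E (p (s eta)) + E eta)))).
  apply: integral_le => eta.
  rewrite /E /F /grad_exch /grad_flip (flip_exchange x y eta) -/s -/p.
  have young (a b c : R) : (a + b + c) ^+ 2
      <= (1 + t) * b ^+ 2 + 2 * (1 + t^-1) * (a ^+ 2 + c ^+ 2).
    have ti : t * t^-1 = 1 by rewrite divff // gt_eqF.
    have ti0 : 0 < t^-1 by rewrite invr_gt0.
    rewrite -subr_ge0.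
    have -> : (1 + t) * b ^+ 2 + 2 * (1 + t^-1) * (a ^+ 2 + c ^+ 2)
        - (a + b + c) ^+ 2
      = t^-1 * (t * b - (a + c)) ^+ 2 + (1 + t^-1) * (a - c) ^+ 2.
      by field; rewrite gt_eqF.
    by rewrite addr_ge0 // mulr_ge0 ?sqr_ge0 // ?addr_ge0 // ltW.
  apply: le_trans (young _ _ _); rewrite le_eqVlt; apply/orP; left; apply/eqP.
  by congr (_ ^+ 2); rewrite /s /p; ring.
rewrite integralD !integralZ integralD.
have h1 := sle _ F0; have h2 := sle (fun eta => E (p eta)) (fun eta => E0 _).
have h3 := ple _ E0.
rewrite -[dirichlet_flip u x g]/(integral nu F).
rewrite -[dirichlet_exch u x y g]/(integral nu E).
apply: lerD.
  by rewrite -mulrA ler_wpM2l // addr_ge0 // ltW.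
rewrite -[leRHS]mulrA ler_wpM2l //; first by rewrite mulr_ge0 // addr_ge0 // invr_ge0 ltW.
rewrite mulrDl mul1r lerD2r (le_trans h2) // -mulrA ler_wpM2l //.
Qed.

(** Induction along the bonds from the first site to [x]. Each step multiplies by a factor at least
    1, so every bond term is absorbed into the [k]-th power. *)
Lemma dirichlet_flip_le_first (t d : R) (k : nat) x g :
  0 < t -> (forall y z, right_nbr y z -> `|u z - u y| <= d) ->
  nat_of_ord x = k ->
  dirichlet_flip u x g
    <= ((1 + t) * (1 + d / eps0 ^+ 2)) ^+ k
       * (dirichlet_flip u (first_site n) g
          + 2 * (1 + t^-1) * ((1 + d / eps0 ^+ 2) / eps0 + 1)
            * \sum_(y : Lambda n | (y < k)%N)
                \sum_(z | right_nbr y z) dirichlet_exch u y z g).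
Proof.
move=> t0 ud; set B := 2 * _ * _; set r := (1 + t) * _.
have ex0 y z : 0 <= dirichlet_exch u y z g.
  by apply: integral_ge0 => eta; apply: sqr_ge0.
elim: k x => [|k IHk] x xk.
  have -> : x = first_site n by apply/val_inj.
  by rewrite big_pred0 // mulr0 addr0 expr0 mul1r.
have kn : (k < n.-2.+1)%N by rewrite -ltnS -xk ltnW // ltnS ltn_ord.
pose y : Lambda n := Ordinal kn.
have yx : right_nbr y x by rewrite /right_nbr xk.
have d0 : 0 <= d := le_trans (normr_ge0 _) (ud _ _ yx).
have c0 : 0 <= d / eps0 ^+ 2 by rewrite divr_ge0 // sqr_ge0.
have r1 : 1 <= r by rewrite /r; nra.
have B0 : 0 <= B.
  rewrite /B mulr_ge0 // ?mulr_ge0 ?addr_ge0 // ?divr_ge0 ?invr_ge0 ?addr_ge0 //; exact: ltW.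
have neq : y != x by apply/eqP=> /(congr1 (@nat_of_ord _)); rewrite xk => /eqP; rewrite ltn_eqF.
apply: (le_trans (dirichlet_flip_step g t0 neq (ud _ _ yx))).
rewrite -/r -/B.
rewrite (bigD1 y) //=.
have -> : \sum_(i : Lambda n | (i < k.+1)%N && (i != y))
      \sum_(z | right_nbr i z) dirichlet_exch u i z g
    = \sum_(i : Lambda n | (i < k)%N)
      \sum_(z | right_nbr i z) dirichlet_exch u i z g.
  apply: eq_bigl => i; rewrite ltnS [in RHS]ltn_neqAle andbC.
  by congr (_ && _).
have := IHk y erefl.
(* The bond from [y] to [x] pays for the step; of the remainder [S1] only nonnegativity matters. *)
rewrite [\sum_(z | right_nbr y z) _](bigD1 x) //=.
set S := \sum_(i | _) _; set S1 := \sum_(i | _) dirichlet_exch _ _ _ _.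
set E := dirichlet_exch u y x g; set D0 := dirichlet_flip u (first_site n) g.
have S10 : 0 <= S1 by apply: sumr_ge0.
move=> h; apply: (@le_trans _ _ (r * (r ^+ k * (D0 + B * S)) + B * E)).
  by rewrite lerD2r ler_wpM2l // (le_trans ler01 r1).
have -> : r ^+ k.+1 * (D0 + B * (E + S1 + S))
  = r * (r ^+ k * (D0 + B * S)) + r ^+ k.+1 * (B * (E + S1)) by rewrite exprS; ring.
rewrite lerD2l.
apply: (@le_trans _ _ (B * (E + S1))); first by rewrite ler_wpM2l // lerDl.
by rewrite ler_peMl ?exprn_ege1 // mulr_ge0 // addr_ge0 // ex0.
Qed.

End Bernoulli.

(** * Choice of constants and conclusion *)

Theorem theorem4p1 (R : realType) (theta kappa eps0 : R)
    (theta_gt0 : 0 < theta) (kappa_gt0 : 0 < kappa)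
    (eps0_gt0 : 0 < eps0) (eps0_le_half : eps0 <= 2^-1) :
  exists2 K : R, 0 < K &
    forall (n : nat), (2 <= n)%N ->
    forall (u : Lambda n -> R), profile_class kappa eps0 u ->
    forall (f : Omega n -> R), density (bernoulli_prod u) f ->
      entropy (bernoulli_prod u) f
        <= n%:R ^+ 2 / K * dirichlet theta u (fun eta => Num.sqrt (f eta)).
Proof.
pose c := kappa / eps0 ^+ 2.
have c0 : 0 < c by rewrite divr_gt0 ?exprn_gt0.
pose M := (1 + c) / eps0 + 1.
have M0 : 0 < M by rewrite addr_gt0 // divr_gt0 // addr_gt0.
(* [A] joins the entropy constant to the growth over all steps; in [B], [theta^-1] serves the
   boundary term and [4 * M] the bonds. *)
pose A := 2 / eps0 * expR (1 + c).
have A0 : 0 < A by rewrite mulr_gt0 ?expR_gt0 ?divr_gt0.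
pose B := theta^-1 + 4 * M.
have B0 : 0 < B by rewrite addr_gt0 ?invr_gt0 ?mulr_gt0.
exists (A * B)^-1; first by rewrite invr_gt0 mulr_gt0.
move=> n n2 u [_ u_bd u_lip] f fd; rewrite invrK.
have site_nb : (n.-2.+1 <= n)%N by case: n n2 {u u_bd u_lip f fd} => [|[]].
have N2 : 2 <= n%:R :> R by rewrite ler_nat.
have N0 : 0 < n%:R :> R by lra.
set N : R := n%:R in N2 N0 *.
set g := fun eta => Num.sqrt (f eta).
have lip x y : right_nbr x y -> `|u y - u x| <= kappa / N.
  by move=> /u_lip; rewrite -/N mulrC -ler_pdivlMr.
have ex0 y z : 0 <= dirichlet_exch u y z g.
  by apply: (integral_ge0 eps0_gt0 u_bd) => eta; apply: sqr_ge0.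
have fl0 : 0 <= dirichlet_flip u (first_site n) g.
  by apply: (integral_ge0 eps0_gt0 u_bd) => eta; apply: sqr_ge0.
rewrite /dirichlet; set D0 := dirichlet_flip u (first_site n) g in fl0 *.
set S := \sum_(x : Lambda n) _.
have S0 : 0 <= S by apply: sumr_ge0 => y _; apply: sumr_ge0.
have cN : kappa / N / eps0 ^+ 2 = c / N by rewrite /c; ring.
have site_bd x : dirichlet_flip u x g
    <= expR (1 + c) * (D0 + 4 * N * M * S).
  (* With [t = N^-1] a step costs at most [expR ((1 + c) / N)], so at most [N] steps stay bounded;
     the price is the factor [1 + N] on the bonds. *)
  have := @dirichlet_flip_le_first R n u eps0 eps0_gt0 u_bd N^-1 (kappa / N) x x g.
  rewrite invr_gt0 invrK cN => /(_ N0 lip erefl) /le_trans; apply.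
  set r := (1 + N^-1) * (1 + c / N).
  have cN_le : c / N <= c by rewrite ler_pdivrMr // ler_peMr //; [exact: ltW|lra].
  have cN0 : 0 < c / N by rewrite divr_gt0.
  have r0 : 0 <= r by rewrite mulr_ge0 // addr_ge0 ?invr_ge0 // ltW.
  have r_le : r ^+ x <= expR (1 + c).
    apply: (@le_trans _ _ (expR ((1 + c) / N) ^+ x)).
      apply: lerXn2r; rewrite ?nnegrE // ?expR_ge0 //.
      have -> : (1 + c) / N = N^-1 + c / N by ring.
      rewrite expRD ler_pM ?expR_ge1Dx // addr_ge0 // ?invr_ge0 ltW //.
    rewrite -expRM_natr ler_expR mulrAC -mulrA ler_piMr //; first lra.
    rewrite ler_pdivrMr // mul1r ler_nat.
    exact: leq_trans (ltnW (ltn_ord x)) site_nb.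
  set b := 2 * (1 + N) * _; set P := \sum_(y : Lambda n | _) _.
  have P0 : 0 <= P by apply: sumr_ge0 => y _; apply: sumr_ge0.
  have m0 : 0 < (1 + c / N) / eps0 + 1 by rewrite addr_gt0 ?divr_gt0 ?addr_gt0.
  have b0 : 0 <= b by rewrite mulr_ge0 ?(ltW m0) //; lra.
  have b_le : b <= 4 * N * M.
    apply: ler_pM; [by lra|exact: ltW|by lra|].
    by rewrite lerD2r ler_pM2r ?invr_gt0 // lerD2l.
  have P_le : P <= S.
    rewrite /S [leRHS](bigID (fun y : Lambda n => (y < x)%N)) /=.
    by rewrite lerDl; apply: sumr_ge0 => y _; apply: sumr_ge0.
  apply: ler_pM r_le _; first by rewrite exprn_ge0.
    by rewrite addr_ge0 // mulr_ge0.
  by rewrite lerD2l; apply: ler_pM.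
apply: (le_trans (product_logsob eps0_gt0 u_bd fd)); rewrite -/g.
apply: (@le_trans _ _ (2 / eps0 * (N * (expR (1 + c) * (D0 + 4 * N * M * S))))).
  rewrite ler_pM2l ?divr_gt0 //.
  apply: (le_trans (ler_sum _ (fun x _ => site_bd x))).
  rewrite sumr_const card_ord -[leLHS]mulr_natl ler_wpM2r //.
    by rewrite mulr_ge0 ?expR_ge0 // addr_ge0 // !mulr_ge0 // ltW.
  by rewrite ler_nat.
have -> : 2 / eps0 * (N * (expR (1 + c) * (D0 + 4 * N * M * S)))
    = A * (N * D0 + 4 * M * N ^+ 2 * S) by rewrite /A; ring.
(* Expanding [B] gives the two needed terms plus a nonnegative surplus. *)
have -> : N ^+ 2 * (A * B) * (theta / N * D0 + S)
    = A * (N * D0 + 4 * M * N ^+ 2 * S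
           + (theta^-1 * (N ^+ 2 * S) + 4 * M * theta * N * D0)).
  by rewrite /B; field; rewrite !gt_eqF.
rewrite ler_pM2l // lerDl addr_ge0 // !mulr_ge0 // ?invr_ge0 ?exprn_ge0 //; exact: ltW.
Qed.
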